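(* Let $\mathsf{x}\in\mathbb{R}^m$ be a random vector and let $n\in\mathbb{N}$ with $n\le m$ and $n>K(\mathsf{x})$. Then there exists a Borel measurable mapping $g\colon\mathbb{R}^{n\times m}\times\mathbb{R}^n\to\mathbb{R}^m$ such that $$\mathbb{P}[g(\mathbf{A},\mathbf{A}\mathsf{x})\neq\mathsf{x}]=0\quad\text{for }\lambda^{n\times m}\text{-almost all }\mathbf{A}\in\mathbb{R}^{n\times m}.$$
   Context: For nonempty $\mathcal{U}\subseteq\mathbb{R}^m$ and $\rho>0$, $N_{\mathcal U}(\rho)$ denotes the smallest number of open Euclidean balls of radius $\rho$ covering $\mathcal U$ ($=\infty$ if no finite cover exists). The lower and upper Minkowski dimensions are $\underline{\dim}_{\mathrm B}(\mathcal U)=\liminf_{\rho\to0}\frac{\log N_{\mathcal U}(\rho)}{\log(1/\rho)}$ and $\overline{\dim}_{\mathrm B}(\mathcal U)=\limsup_{\rho\to0}\frac{\log N_{\mathcal U}(\rho)}{\log(1/\rho)}$. The lower modified Minkowski dimension is $\underline{\dim}_{\mathrm{MB}}(\mathcal U)=\inf\{\sup_{i\in\mathbb N}\underline{\dim}_{\mathrm B}(\mathcal U_i):\mathcal U\subseteq\bigcup_{i\in\mathbb N}\mathcal U_i\}$, the infimum taken over all countable covers of $\mathcal U$ by nonempty bounded sets $\mathcal U_i$; the upper modified Minkowski dimension $\overline{\dim}_{\mathrm{MB}}$ is defined the same way with $\overline{\dim}_{\mathrm B}$. A support set of a random vector $\mathsf x\in\mathbb R^m$ is any set $\mathcal U\subseteq\mathbb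 R^m$ with $\mathbb P[\mathsf x\in\mathcal U]=1$. The description complexity of $\mathsf x$ is $K(\mathsf x)=\inf\{\underline{\dim}_{\mathrm{MB}}(\mathcal U):\mathcal U\text{ a support set of }\mathsf x\}$. $\lambda^{n\times m}$ is Lebesgue measure on $\mathbb R^{n\times m}$. *)

(* Defs.v *)
From mathcomp Require Import all_boot all_order all_algebra.
From mathcomp Require Import all_classical all_reals all_analysis.

Set Implicit Arguments.
Unset Strict Implicit.
Unset Printing Implicit Defensive.

Import Order.TTheory GRing.Theory Num.Theory.
Import numFieldNormedType.Exports.
Local Open Scope classical_set_scope.
Local Open Scope ring_scope.

Section Defs.
Variable R : realType.

(* Borel sigma-algebra of a topological space: generated by the open sets.
   R^k is 'cV[R]_k and R^(n x m) is 'M[R]_(n,m) with the (product) matrix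
   topology, i.e. the Euclidean topology; a product space carries the
   product topology. *)
Definition borel_sets (X : topologicalType) : set (set X) := <<s open >>.

Definition borel_measurable (X Y : topologicalType) (f : X -> Y) : Prop :=
  forall B, borel_sets B -> borel_sets (f @^-1` B).

Definition random_vector d (T : measurableType d) (m : nat)
  (x : T -> 'cV[R]_m) : Prop :=
  forall B : set 'cV[R]_m, borel_sets B -> measurable (x @^-1` B).

Definition mx_box (n m : nat) (a b : 'M[R]_(n, m)) : set 'M[R]_(n, m) :=
  [set A | forall i j, a i j < A i j < b i j].
Definition mx_box_vol (n m : nat) (a b : 'M[R]_(n, m)) : R :=
  \prod_(i < n) \prod_(j < m) Num.max 0 (b i j - a i j).

Definition leb_null (n m : nat) (N : set 'M[R]_(n, m)) : Prop :=
  forall eps : R, 0 < eps ->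
    exists a b : nat -> 'M[R]_(n, m),
      N `<=` \bigcup_k mx_box (a k) (b k) /\
      forall K, \sum_(k < K) mx_box_vol (a k) (b k) <= eps.

Definition leb_ae (n m : nat) (Q : 'M[R]_(n, m) -> Prop) : Prop :=
  leb_null [set A | ~ Q A].

Definition eucl_norm (m : nat) (v : 'cV[R]_m) : R :=
  Num.sqrt (\sum_(i < m) v i 0 ^+ 2).

Definition eucl_ball (m : nat) (c : 'cV[R]_m) (rho : R) : set 'cV[R]_m :=
  [set v | eucl_norm (v - c) < rho].

Definition eucl_bounded (m : nat) (U : set 'cV[R]_m) : Prop :=
  exists M : R, forall v, U v -> eucl_norm v <= M.

(* N_U(rho): least number of open Euclidean balls of radius rho covering U
   (+oo if there is no finite cover) *)
Definition cov_num (m : nat) (U : set 'cV[R]_m) (rho : R) : \bar R :=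
  ereal_inf [set (k%:R)%:E | k in
    [set k : nat | exists c : 'I_k -> 'cV[R]_m,
       U `<=` [set v | exists i, eucl_ball (c i) rho v]]].

Definition mink_ratio (m : nat) (U : set 'cV[R]_m) (rho : R) : \bar R :=
  match cov_num U rho with
  | r%:E => (ln r / ln rho^-1)%:E
  | +oo%E => +oo%E
  | -oo%E => -oo%E
  end.

(* liminf_{rho -> 0} = sup_{0<delta<1} inf_{0<rho<delta} *)
Definition lower_box_dim (m : nat) (U : set 'cV[R]_m) : \bar R :=
  ereal_sup [set ereal_inf [set mink_ratio U rho | rho in [set rho : R | 0 < rho < delta]]
            | delta in [set delta : R | 0 < delta < 1]].

Definition lower_mod_box_dim (m : nat) (U : set 'cV[R]_m) : \bar R :=
  ereal_inf [set ereal_sup [set lower_box_dim (F i) | i in [set: nat]]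
            | F in [set F : nat -> set 'cV[R]_m |
                U `<=` \bigcup_i F i /\
                forall i, F i !=set0 /\ eucl_bounded (F i)]].

(* U is a support set of x: P[x \in U] = 1, i.e. the event {x \in U}
   contains a measurable event of probability one *)
Definition support_set d (T : measurableType d) (P : probability T R)
  (m : nat) (x : T -> 'cV[R]_m) (U : set 'cV[R]_m) : Prop :=
  exists E, measurable E /\ P E = 1%E /\ E `<=` x @^-1` U.

Definition descr_complexity d (T : measurableType d) (P : probability T R)
  (m : nat) (x : T -> 'cV[R]_m) : \bar R :=
  ereal_inf [set lower_mod_box_dim U | U in support_set P x].

End Defs.

(* Main.v *)
(**
A support set of x is covered by sets F_i which, at arbitrarily small scales
rho, are covered by N balls of radius rho with N rho^n as small as desired.
Keep only the finite sets of centres. Given (A, y), the decoder computes the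
coordinate l of x as the infimum of the t such that for some i, at every
scale of F_i, some centre c satisfies c_l <= t + rho and A c = y up to O(rho);
this is a Borel function, built from countably many closed conditions. It
fails at y = A x only if some t < x_l passes the test, hence only if at every
scale A (c - x) = O(rho) for some centre c bounded away from x. For fixed x
and c the set of such bounded A is an intersection of n slabs, one for each
row, of volume O(rho^n), so the union over the centres has volume
O(N rho^n) -> 0.

The exchange of "for every x, almost every A" into "for almost every A, almost
every x" is done without a product measure. The matrices are rounded to a grid
of step rho, slabs are estimated by counting grid points, and if each outcome
lies in at most M of finitely many events E_z then the sum of the P(E_z) is at
most M, so few grid cells contain a matrix with failure probability > eta.
These cells are the boxes covering the exceptional set.
*)

Require Import Defs.
From mathcomp Require Import all_boot all_order all_algebra.
From mathcomp Require Import all_classical all_reals all_analysis.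
From mathcomp Require Import measurable_realfun ring lra.

Import Order.TTheory GRing.Theory Num.Theory.
Import numFieldNormedType.Exports.
Local Open Scope classical_set_scope.
Local Open Scope ring_scope.

(** * Borel sets under countable operations *)

Section BorelSets.
Context {X : topologicalType}.
Implicit Type A : set X.

Lemma borel_open A : open A -> borel_sets A.
Proof. exact: sub_sigma_algebra. Qed.

Lemma borelC A : borel_sets A -> borel_sets (~` A).
Proof.
have [_ + _] := smallest_sigma_algebra [set: X] (@open X).
by move=> /[apply]; rewrite setTD.
Qed.

Lemma borel_closed A : closed A -> borel_sets A.
Proof.
by move=> cA; rewrite -(setCK A); apply: borelC; apply: borel_open; exact: closed_openC.
Qed.

Lemma borel_cst (Q : Prop) : borel_sets [set _ : X | Q].
Proof.
have [q|nq] := pselect Q; apply: borel_open.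
- by rewrite (_ : [set _ | _] = setT); [exact: openT|apply/seteqP; split].
- by rewrite (_ : [set _ | _] = set0); [exact: open0|apply/seteqP; split].
Qed.

Lemma borel_exists (I : countType) (F : I -> set X) :
  (forall i, borel_sets (F i)) -> borel_sets [set x | exists i, F i x].
Proof.
move=> bF; rewrite (_ : [set x | _] =
  \bigcup_k if @unpickle I k is Some i then F i else set0).
  apply: sigma_algebra_bigcup => k; case: unpickle => [i|]; first exact: bF.
  exact: (borel_cst False).
apply/seteqP; split=> [x [i Fix]|x [k _]].
  by exists (pickle i) => //=; rewrite pickleK.
by case: unpickle => // i Fix; exists i.
Qed.

Lemma borel_forall (I : countType) (F : I -> set X) :
  (forall i, borel_sets (F i)) -> borel_sets [set x | forall i, F i x].
Proof.
move=> bF; rewrite (_ : [set x | _] = ~` [set x | exists i, (~` F i) x]).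
  by apply: borelC; apply: borel_exists => i; exact: borelC.
apply/seteqP; split=> [x Fx [i]|x nFx i]; first exact.
by apply: contrapT => nFix; apply: nFx; exists i.
Qed.

Lemma borel_and (P Q : X -> Prop) : borel_sets [set x | P x] ->
  borel_sets [set x | Q x] -> borel_sets [set x | P x /\ Q x].
Proof.
move=> bP bQ; rewrite (_ : [set x | _] =
  [set x | forall b : bool, (if b then P else Q) x]).
  by apply: borel_forall => -[].
apply/seteqP; split=> [x [Px Qx] []//|x PQx].
by split; [exact: (PQx true)|exact: (PQx false)].
Qed.

Lemma borel_or (P Q : X -> Prop) : borel_sets [set x | P x] ->
  borel_sets [set x | Q x] -> borel_sets [set x | P x \/ Q x].
Proof.
move=> bP bQ; rewrite (_ : [set x | _] =
  [set x | exists b : bool, (if b then P else Q) x]).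
  by apply: borel_exists => -[].
apply/seteqP; split=> [x [Px|Qx]|x [[]]]; [by exists true|by exists false|..]; by [left|right].
Qed.

Lemma borel_not (P : X -> Prop) : borel_sets [set x | P x] ->
  borel_sets [set x | ~ P x].
Proof. exact: borelC. Qed.

Lemma borel_measurable_open (Y : topologicalType) (f : X -> Y) :
  (forall B, open B -> borel_sets (f @^-1` B)) -> borel_measurable f.
Proof.
move=> fo B; apply: (smallest_sub (X := [set B | borel_sets (f @^-1` B)])) => //.
split=> /= [|C bC|C bC].
- by rewrite preimage_set0; exact: (borel_cst False).
- by rewrite setTD preimage_setC; exact: borelC.
- by rewrite preimage_bigcup; exact: sigma_algebra_bigcup.
Qed.

Lemma continuous_borel (Y : topologicalType) (f : X -> Y) :
  continuous f -> borel_measurable f.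
Proof.
by move=> /continuousP cf; apply: borel_measurable_open => B /cf; exact: borel_open.
Qed.

End BorelSets.

(** * Borel conditions on real and matrix valued functions *)

Section BorelReal.
Context {R : realType} {X : topologicalType}.

Lemma borel_continuous_le (f g : X -> R) : continuous f -> continuous g ->
  borel_sets [set z | f z <= g z].
Proof.
move=> cf cg; apply: borel_closed.
rewrite (_ : [set z | _] = (fun z => g z - f z) @^-1` [set r | 0 <= r]).
  apply: preimage_closed; last exact: closed_ge.
  by move=> z _; apply: cvgB; [exact: cg|exact: cf].
by apply/seteqP; split=> z /=; rewrite subr_ge0.
Qed.

Lemma borel_continuous_lt (f : X -> R) (r : R) : continuous f ->
  borel_sets [set z | f z < r].
Proof.
move=> cf; rewrite (_ : [set z | _] = ~` [set z | cst r z <= f z]).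
  by apply: borelC; apply: borel_continuous_le => // z; exact: cvg_cst.
by apply/seteqP; split=> z /=; [move=> fr; apply/negP|move/negP]; rewrite -ltNge.
Qed.

(** [f z] exceeds [r] exactly when some rational [q] satisfies [r < q <= f z], so the complement is
    a countable union. *)
Lemma borel_lt_le (f : X -> R) : (forall r, borel_sets [set z | f z < r]) ->
  forall r, borel_sets [set z | f z <= r].
Proof.
move=> bf r; rewrite (_ : [set z | _] =
  [set z | forall q : rat, ~ (r < ratr q /\ ~ f z < ratr q)]).
  apply: borel_forall => q; apply: borel_not; apply: borel_and.
    exact: (@borel_cst X (r < ratr q)).
  exact: borel_not (bf _).
apply/seteqP; split=> z /= fz.
  by move=> q [rq]; apply; exact: le_lt_trans rq.
rewrite leNgt; apply/negP => /rat_in_itvoo[q]; rewrite in_itv/= => /andP[rq qf].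
by apply: (fz q); split => //; apply/negP; rewrite -leNgt ltW.
Qed.

(** An open set of matrices is the union of the rational open boxes that it contains. There are
    countably many of them, so conditions on single entries suffice. *)
Lemma borel_measurable_mx (m n : nat) (f : X -> 'M[R]_(m, n)) :
  (forall i j r, borel_sets [set z | f z i j < r]) -> borel_measurable f.
Proof.
move=> bf; apply: borel_measurable_open => B oB.
pose I : countType := ('M[rat]_(m, n) * 'M[rat]_(m, n))%type.
pose box (ab : I) : set 'M[R]_(m, n) :=
  [set M | forall i j, ratr (ab.1 i j) < M i j /\ M i j < ratr (ab.2 i j)].
rewrite (_ : _ @^-1` _ =
  [set z | exists ab : I, (box ab `<=` B) /\ forall i j,
    ~ f z i j <= ratr (ab.1 i j) /\ f z i j < ratr (ab.2 i j)]).
  apply: borel_exists => ab; apply: borel_and; first exact: (@borel_cst X (box ab `<=` B)).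
  apply: borel_forall => i; apply: borel_forall => j; apply: borel_and => //.
  by apply: borel_not; exact: borel_lt_le.
apply/seteqP; split=> z /=; last first.
  move=> [ab [abB fz]]; apply: abB => i j.
  by have [/negP + ?] := fz i j; rewrite -ltNge.
move=> Bfz; have [V nV VB] : nbhs (f z) B by exact: open_nbhs_nbhs.
have rb i j : {q : rat * rat | (ratr q.1 < f z i j < ratr q.2) /\
    forall y : R, ratr q.1 < y < ratr q.2 -> V i j y}.
  apply: cid; have /nbhs_ballP[e /= e0 eV] := nV i j.
  have /rat_in_itvoo[q1] : f z i j - e < f z i j by rewrite gtrBl.
  have /rat_in_itvoo[q2] : f z i j < f z i j + e by rewrite ltrDl.
  rewrite !in_itv/= => /andP[q21 q22] /andP[q11 q12].
  exists (q1, q2) => /=; rewrite q12 q21; split=> // y /andP[y1 y2].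
  apply: eV; rewrite /ball/= ltr_norml; lra.
exists (\matrix_(i, j) (sval (rb i j)).1, \matrix_(i, j) (sval (rb i j)).2).
split=> [M /= bM|i j].
  apply: VB => i j; have := bM i j; rewrite !mxE => -[M1 M2].
  by case: (rb i j) M1 M2 => /= q [_ qV] M1 M2; apply: qV; rewrite M1.
rewrite !mxE; case: (rb i j) => /= q [/andP[q1 q2] _].
by rewrite q2; split => //; apply/negP; rewrite -ltNge.
Qed.

End BorelReal.

(** * Lebesgue null sets of matrices *)

Section LebesgueNull.
Context {R : realType}.

Lemma leb_null_sub (n m : nat) (N N' : set 'M[R]_(n, m)) :
  N `<=` N' -> leb_null N' -> leb_null N.
Proof.
move=> NN' nullN' e /nullN'[a [b [N'ab vol]]]; exists a, b; split => //.
exact: subset_trans N'ab.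
Qed.

Lemma mx_box_vol_ge0 (n m : nat) (a b : 'M[R]_(n, m)) : 0 <= mx_box_vol a b.
Proof.
by apply: prodr_ge0 => i _; apply: prodr_ge0 => j _; rewrite le_max lexx.
Qed.

Lemma mx_box_vol_diag (n m : nat) (a : 'M[R]_(n.+1, m.+1)) : mx_box_vol a a = 0.
Proof. by rewrite /mx_box_vol !big_ord_recl subrr maxxx !mul0r. Qed.

(** The list is padded to a sequence by the box from 0 to 0. Its volume is 0 because both dimensions
    are positive; an empty product would give 1. *)
Lemma leb_null_finite_cover (n m : nat) (N : set 'M[R]_(n.+1, m.+1)) :
  (forall eps : R, 0 < eps -> exists s : seq ('M[R]_(n.+1, m.+1) * 'M[R]_(n.+1, m.+1)),
    (forall A, N A -> exists2 ab, ab \in s & mx_box ab.1 ab.2 A) /\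
    \sum_(ab <- s) mx_box_vol ab.1 ab.2 <= eps) -> leb_null N.
Proof.
move=> fin e /fin[s [Ns vol]].
exists (fun k => (nth (0, 0) s k).1), (fun k => (nth (0, 0) s k).2); split.
  move=> A /Ns[ab abs Aab]; exists (index ab s) => //.
  by rewrite nth_index.
move=> K; apply: le_trans vol; elim: s {Ns} K => [|ab s IH] [|K].
- by rewrite big_ord0 big_nil.
- by rewrite big_nil big1// => i _; rewrite nth_nil mx_box_vol_diag.
- by rewrite big_ord0; apply: sumr_ge0 => i _; exact: mx_box_vol_ge0.
- by rewrite big_ord_recl big_cons lerD2l; exact: IH.
Qed.

(** The set [N i] gets a cover of volume at most [e / 2 ^+ (pickle i).+1]. The boxes of all covers
    are listed along the codes of pairs [(i, k)]; numbers coding no pair get a box of volume 0. *)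
Lemma leb_null_exists (n m : nat) (I : countType)
    (N : I -> set 'M[R]_(n.+1, m.+1)) :
  (forall i, leb_null (N i)) -> leb_null [set A | exists i, N i A].
Proof.
move=> nullN e e0.
pose M : Type := 'M[R]_(n.+1, m.+1).
have cover i : {ab : nat -> M * M |
    (N i `<=` \bigcup_k mx_box (ab k).1 (ab k).2) /\
    forall K, \sum_(k < K) mx_box_vol (ab k).1 (ab k).2 <= e / 2 ^+ (pickle i).+1}.
  apply: cid; have ei0 : 0 < e / 2 ^+ (pickle i).+1 by rewrite divr_gt0 // exprn_gt0.
  have [a [b abP]] := nullN i _ ei0.
  by exists (fun k => (a k, b k)).
pose ab (q : option (I * nat)) : M * M :=
  if q is Some (i, k) then sval (cover i) k else (0, 0).
exists (fun k => (ab (pickle_inv k)).1), (fun k => (ab (pickle_inv k)).2); split.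
  move=> A [i NiA]; have [/(_ A NiA)[k _ Aik] _] := svalP (cover i).
  by exists (pickle (i, k)) => //; rewrite pickleK_inv.
move=> K; pose v q := mx_box_vol (ab q).1 (ab q).2.
have v0 q : 0 <= v q by exact: mx_box_vol_ge0.
(* All pairs coded below [K] have both indices below [J], so the partial sum can be compared with a
   [J] by [J] double sum. In [w] and [hit], an element of [I] is replaced by its code. *)
pose J := (\max_(k < K) if pickle_inv k is Some (i, j) then
  (pickle (i : I) + j)%N else 0%N).+1.
pose w i j := v (if pickle_inv i is Some i' then Some (i' : I, j) else None).
pose hit (i j k : nat) := if pickle_inv k is Some (i', j') then
   (pickle (i' : I) == i) && (j' == j) else false.
have vhit (k : 'I_K) : v (pickle_inv k) = \sum_(i < J) \sum_(j < J) (hit i j k)%:R * w i j.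
  case E : (pickle_inv k : option (I * nat)) => [[i j]|]; last first.
    rewrite /v /= mx_box_vol_diag big1// => i _; rewrite big1// => j _.
    by rewrite /hit E mul0r.
  have ijJ : (pickle i + j < J)%N.
    rewrite ltnS; apply: leq_trans (leq_bigmax k).
    by rewrite E.
  have iJ : (pickle i < J)%N by apply: leq_ltn_trans ijJ; exact: leq_addr.
  have jJ : (j < J)%N by apply: leq_ltn_trans ijJ; exact: leq_addl.
  rewrite (bigD1 (Ordinal iJ))//= (bigD1 (Ordinal jJ))//= {1}/hit E !eqxx mul1r.
  rewrite /w pickleK_inv big1 ?addr0; last first.
    by move=> j' /negPf j'j; rewrite /hit E (eq_sym j) -[_ == j]/(j' == Ordinal jJ) j'j andbF mul0r.
  rewrite big1 ?addr0// => i' /negPf i'i; rewrite big1// => j' _.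
  by rewrite /hit E (eq_sym (pickle i)) -[_ == pickle i]/(i' == Ordinal iJ) i'i mul0r.
rewrite (eq_bigr _ (fun k _ => vhit k)) exchange_big/=.
apply: (@le_trans _ _ (\sum_(i < J) e / 2 ^+ i.+1)); last first.
  rewrite -mulr_sumr ger_pMr//.
  suff -> : \sum_(i < J) (2 ^+ i.+1)^-1 = 1 - (2 ^+ J)^-1 :> R.
    by rewrite gerBl invr_ge0 exprn_ge0.
  move: (J) => J'; elim: J' => [|J' IH]; first by rewrite big_ord0 expr0 invr1 subrr.
  rewrite big_ord_recr/= IH exprS invfM; lra.
apply: ler_sum => i _; rewrite exchange_big/=.
(* Decoding is injective, so each [w i j] is hit by at most one [k]. *)
apply: (@le_trans _ _ (\sum_(j < J) w i j)).
  apply: ler_sum => j _; rewrite -mulr_suml ler_piMl//; first exact: v0.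
  rewrite -natr_sum (_ : 1 = 1%:R)// ler_nat.
  have [k hk|nohit] := pickP (fun k : 'I_K => hit i j k); last first.
    by rewrite big1// => k _; rewrite nohit.
  rewrite (bigD1 k)//= hk big1// => k' k'k; apply/eqP; rewrite eqb0.
  apply: contraNN k'k => hk'; apply/eqP/val_inj => /=.
  move: hk hk'; rewrite /hit; have := pickle_invK (T := (I * nat)%type) k.
  have := pickle_invK (T := (I * nat)%type) k'.
  case: pickle_inv => [[i1 j1]|]//= <-; case: pickle_inv => [[i2 j2]|]//= <-.
  move=> /andP[/eqP e1 /eqP ->] /andP[/eqP e2 /eqP ->].
  by have /(pcan_inj pickleK) -> : pickle i1 = pickle i2 by rewrite e1 e2.
rewrite /w; case E : (pickle_inv i : option I) => [i'|].
  rewrite -(_ : pickle i' = i); last by have := pickle_invK (T := I) i; rewrite E.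
  by have [_] := svalP (cover i'); exact.
rewrite big1 ?divr_ge0 ?exprn_ge0 ?(ltW e0)// => j _.
by rewrite /v mx_box_vol_diag.
Qed.

End LebesgueNull.

(** * Averaging over finitely many events, and counting grid points *)

(** The sum is the expectation of the number of events that occur, and this number is at most [M]
    everywhere. *)
Lemma sum_probability_le (R : realType) (d : measure_display)
    (T : measurableType d) (P : probability T R) (Z : finType) (A : {set Z})
    (E : Z -> set T) (M : nat) :
  (forall z, measurable (E z)) ->
  (forall w, (#|[set z in A | `[< E z w >]]%SET| <= M)%N) ->
  (\sum_(z in A) P (E z) <= M%:R%:E)%E.
Proof.
move=> mE countE.
have -> : (\sum_(z in A) P (E z) = \int[P]_w \sum_(z <- enum A) (\1_(E z) w)%:E)%E.
  rewrite ge0_integral_sum//=.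
  - by rewrite -big_enum; apply: eq_bigr => z _; rewrite integral_indic// setIT.
  - by move=> z; apply/measurable_EFinP; exact: measurable_indic.
apply: (@le_trans _ _ (\int[P]_w cst M%:R%:E w)%E); last first.
  by rewrite integral_cst// [X in (_ * X)%E](_ : _ = 1%E) ?mule1//; exact: probability_setT.
apply: ge0_le_integral => //.
- by move=> w _; apply: sume_ge0.
- apply: emeasurable_sum => z; apply/measurable_EFinP; exact: measurable_indic.
- move=> w _; rewrite sumEFin lee_fin.
  apply: le_trans (_ : #|[set z in A | `[< E z w >]]%SET|%:R <= _); last by rewrite ler_nat.
  rewrite -sum1_card natr_sum big_enum/= [leRHS]big_mkcond [leLHS]big_mkcond/=.
  apply: ler_sum => z _; rewrite inE; case: (z \in A) => //=.
  by rewrite indicE; case: (asboolP (E z w)) => h; rewrite ?(mem_set h) ?(memNset h).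
Qed.

Section GridCounting.
Context {R : realType}.

Lemma eq_mod_close (a b k : nat) : `|a%:R - b%:R : R| <= k%:R ->
  a = b %[mod k.+1] -> a = b.
Proof.
wlog ab : a b / (a <= b)%N.
  by move=> H; have [/H//|/ltnW/H h] := leqP a b; rewrite distrC => /h{}h /esym/h.
rewrite distrC -natrB// ger0_norm// ler_nat => bak /esym/eqP.
rewrite eqn_mod_dvd// => /dvdn_leq.
case: (posnP (b - a)) => [/eqP|_ /(_ isT)]; last by rewrite leqNgt ltnS bak.
by rewrite subn_eq0 => ba _; apply/eqP; rewrite eqn_leq ab.
Qed.

(* Two points of the slab that agree off the coordinate j0 differ by at most
   2K at j0, so they are separated by the residue of that coordinate modulo
   2K + 1. *)
Lemma card_grid_slab (m D K : nat) (u : R) (v : 'I_m.+1 -> R) (j0 : 'I_m.+1) :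
  v j0 != 0 ->
  (#|[set f : {ffun 'I_m.+1 -> 'I_D} |
      (`|\sum_j ((f j)%:R - u) * v j| <= K%:R * `|v j0|)%R]%SET|
   <= D ^ m * K.*2.+1)%N.
Proof.
move=> vj0; pose F (f : {ffun 'I_m.+1 -> 'I_D}) :=
  ([ffun j => f (lift j0 j)] : {ffun 'I_m -> 'I_D}, inord (f j0 %% K.*2.+1) : 'I_K.*2.+1).
rewrite -[X in (_ <= X)%N](_ : #|{: {ffun 'I_m -> 'I_D} * 'I_K.*2.+1}| = _)%N; last first.
  by rewrite card_prod card_ffun !card_ord.
apply: (leq_card_in F) => f g; rewrite !inE => fK gK [/ffunP fg /(congr1 val)/=].
rewrite !inordK ?ltn_mod// => modfg.
have fglift j : f (lift j0 j) = g (lift j0 j) by have := fg j; rewrite !ffunE.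
have fgj0 : f j0 = g j0.
  apply/val_inj; apply: eq_mod_close modfg.
  rewrite -(ler_pM2r (_ : 0 < `|v j0|)) ?normr_gt0// -normrM.
  rewrite (_ : _ * _ = \sum_j ((f j)%:R - u) * v j - \sum_j ((g j)%:R - u) * v j).
    apply: le_trans (ler_normB _ _) _; rewrite -mul2n natrM -mulrA mulr_natl mulr2n.
    exact: lerD.
  rewrite -sumrB (bigD1 j0)//= big1 ?addr0; first by rewrite -mulrBl; congr (_ * _); lra.
  by move=> j; rewrite eq_sym => /unlift_some[j' -> _]; rewrite fglift subrr.
by apply/ffunP => j; case: (unliftP j0 j) => [j' ->|->].
Qed.

(** The rows are constrained independently, so the count is the power of the count for one row. *)
Lemma card_grid_slabs (n m D K : nat) (u : R) (v : 'I_m.+1 -> R) (j0 : 'I_m.+1) :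
  v j0 != 0 ->
  (#|[set f : {ffun 'I_n -> {ffun 'I_m.+1 -> 'I_D}} |
      [forall i, (`|\sum_j ((f i j)%:R - u) * v j| <= K%:R * `|v j0|)%R]]%SET|
   <= (D ^ m * K.*2.+1) ^ n)%N.
Proof.
move=> vj0; apply: leq_trans (_ : #|[set f : {ffun 'I_m.+1 -> 'I_D} |
      (`|\sum_j ((f j)%:R - u) * v j| <= K%:R * `|v j0|)%R]%SET| ^ n <= _)%N; last first.
  by case: n => // n; rewrite leq_exp2r//; exact: card_grid_slab.
rewrite -[X in (_ <= _ ^ X)%N](card_ord n) -card_ffun_on; apply: subset_leq_card.
apply/fintype.subsetP => f; rewrite inE => /forallP fv.
by apply/ffun_onP => i; rewrite inE; exact: fv.
Qed.

End GridCounting.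

Lemma card_covered (T : finType) (C : eqType) (s : seq C) (S : C -> {set T})
    (A : {set T}) (M : nat) :
  (forall z, z \in A -> exists2 c, c \in s & z \in S c) ->
  (forall c, #|S c| <= M)%N -> (#|A| <= size s * M)%N.
Proof.
move=> + SM; elim: s A => [|c s IH] A AS.
  by rewrite leqn0 cards_eq0; apply/eqP/setP => z; rewrite inE; apply/negP => /AS[].
rewrite mulSn -(cardsID (S c) A); apply: leq_add.
  by apply: leq_trans (SM c); apply: subset_leq_card; exact: subsetIr.
apply: IH => z; rewrite inE => /andP[zc /AS[c']].
by rewrite inE => /orP[/eqP ->|c's zc']; [rewrite (negPf zc)|exists c'].
Qed.

(** * Null sets of matrices with slab events of positive probability *)

Section SlabEvents.
Context {R : realType}.

(** Rounding the row [a] to the grid costs at most [rho * m * |v j0|], and the slab width is at most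
    [rho * m * L], where [L <= L ^ 2 * |v j0|]. Division by [rho] leaves a bound that does not
    depend on the scale. *)
Lemma grid_slab (m : nat) (a z : 'I_m -> R) (v : 'I_m -> R) (j0 : 'I_m) (L : nat)
    (rho : R) :
  0 < rho -> (forall j, `|a j| <= L%:R) -> (forall j, `|a j - rho * z j| <= rho) ->
  (forall j, `|v j| <= `|v j0|) -> 1 <= L%:R * `|v j0| ->
  `|\sum_j a j * v j| <= rho * \sum_j `|a j| ->
  `|\sum_j z j * v j| <= (m * (L ^ 2).+1)%:R * `|v j0|.
Proof.
move=> rho0 aL az vmax vj0 slab; rewrite -(ler_pM2l rho0).
rewrite -[leLHS](_ : `|\sum_j rho * z j * v j| = _); last first.
  under eq_bigr do rewrite -mulrA.
  by rewrite -mulr_sumr normrM (gtr0_norm rho0).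
have -> : \sum_j rho * z j * v j = \sum_j a j * v j - \sum_j (a j - rho * z j) * v j.
  by rewrite -sumrB; apply: eq_bigr => j _; rewrite mulrBl opprB addrC subrK.
apply: le_trans (ler_normB _ _) _.
have b1 : `|\sum_j a j * v j| <= rho * (m%:R * L%:R).
  apply: le_trans slab _; rewrite ler_pM2l//.
  apply: (@le_trans _ _ (\sum_(j < m) L%:R)); first exact: ler_sum.
  by rewrite sumr_const card_ord mulr_natl.
have b2 : `|\sum_j (a j - rho * z j) * v j| <= rho * (m%:R * `|v j0|).
  apply: le_trans (ler_norm_sum _ _ _) _.
  apply: (@le_trans _ _ (\sum_(j < m) rho * `|v j0|)).
    by apply: ler_sum => j _; rewrite normrM ler_pM.
  by rewrite sumr_const card_ord mulrCA mulr_natl.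
apply: (le_trans (lerD b1 b2)); rewrite -mulrDr ler_pM2l// natrM -mulrA -mulrDr.
rewrite ler_wpM2l// -addn1 natrD mulrDl mul1r lerD2r natrX expr2 -mulrA.
by rewrite ler_peMr.
Qed.

(* An entry A i j with |A i j| < L is rounded to the grid point
   rho * (f i j - G), f i j < 2 G, where G is the least integer > L / rho. *)
Lemma grid_round (L : nat) (rho a : R) (G := (Num.trunc (L%:R / rho)).+1) :
  0 < rho -> `|a| < L%:R ->
  exists z : 'I_(G.*2), rho * (z%:R - G%:R) <= a < rho * (z%:R - G%:R) + rho.
Proof.
move=> rho0; rewrite ltr_norml => /andP[aL La].
have LG : L%:R / rho < G%:R by exact: truncnS_gt.
have aG1 : a / rho < G%:R by apply: lt_trans LG; rewrite ltr_pM2r// invr_gt0.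
have aG0 : 0 <= a / rho + G%:R.
  have : - (L%:R / rho) < a / rho by rewrite -mulNr ltr_pM2r// invr_gt0.
  lra.
have zG : (Num.trunc (a / rho + G%:R) < G.*2)%N.
  rewrite truncn_lt_nat// -mul2n natrM; lra.
exists (Ordinal zG) => /=; have /andP[z1 z2] := truncn_itv aG0.
rewrite mulrC -ler_pdivlMr// [X in _ < X](_ : _ = ((Num.trunc (a / rho + G%:R)).+1%:R - G%:R) * rho).
  rewrite -ltr_pdivrMr//; apply/andP; split; lra.
by rewrite -natr1; ring.
Qed.

Context {d : measure_display} {T : measurableType d} (P : probability T R).

(** A single scale [k] suffices for each [eps]. Every grid cell meeting the set contributes one
    matrix; each outcome lies in few of the events of these matrices, while each event has
    probability above [eta]. This bounds the number of cells. *)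
Lemma leb_null_slab_event (n m L : nat) (x : T -> 'cV[R]_m.+1)
    (B : 'M[R]_(n.+1, m.+1) -> set T) (C : nat -> seq 'cV[R]_m.+1)
    (rho : nat -> R) (eta : R) :
  (forall k, 0 < rho k <= 1) ->
  (forall k, (size (C k))%:R * rho k ^+ n.+1 <= k.+1%:R^-1) ->
  (forall A, measurable (B A)) ->
  (forall A w, B A w -> forall i j, `|A i j| < L%:R) ->
  (forall A w k, (L <= k)%N -> B A w -> exists2 c, c \in C k &
    (exists j, 1 <= L%:R * `|c j 0 - x w j 0|) /\
    forall i, `|\sum_j A i j * (c j 0 - x w j 0)| <= rho k * \sum_j `|A i j|) ->
  0 < eta -> leb_null [set A | (eta%:E < P (B A))%E].
Proof.
move=> rho01 sizeC mB BL Bslab eta0; apply: leb_null_finite_cover => eps eps0.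
pose K := (m.+1 * (L ^ 2).+1)%N.
(* The covering boxes will have volume at most [Q * (size (C k) * rho k ^+ n.+1)]: the power of 2
   comes from doubling the sides of the cells, [2 * (L%:R + 1)] bounds the length of the grid in one
   coordinate, [K.*2.+1] counts grid points across a slab, and [eta] is the probability
   threshold. *)
pose Q : R := 2 ^+ (m.+1 * n.+1) * ((2 * (L%:R + 1)) ^+ m * K.*2.+1%:R) ^+ n.+1 / eta.
pose k := maxn L (Num.trunc (Q / eps)).
have Qk : Q * k.+1%:R^-1 <= eps.
  rewrite ler_pdivrMr// mulrC -ler_pdivrMr//; apply: ltW.
  apply: lt_le_trans (truncnS_gt _) _; rewrite ler_nat ltnS; exact: leq_maxr.
have /andP[r0 r1] := rho01 k; set r := rho k in r0 r1.
set G := (Num.trunc (L%:R / r)).+1.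
pose Z : finType := {ffun 'I_n.+1 -> {ffun 'I_m.+1 -> 'I_(G.*2)}}.
pose corner (z : Z) : 'M[R]_(n.+1, m.+1) := \matrix_(i, j) (r * ((z i j)%:R - G%:R)).
pose cell (z : Z) : set 'M[R]_(n.+1, m.+1) :=
  [set A | forall i j, corner z i j <= A i j < corner z i j + r].
pose bad (z : Z) : set 'M[R]_(n.+1, m.+1) :=
  [set A | cell z A /\ (eta%:E < P (B A))%E].
pose ZB : {set Z} := [set z | `[< bad z !=set0 >]]%SET.
pose rep z := xget 0 (bad z).
have repP z : z \in ZB -> bad z (rep z).
  by rewrite inE => /asboolP[A bA]; exact: (xgetI _ bA).
have count w : (#|[set z in ZB | `[< B (rep z) w >]]%SET| <=
    size (C k) * (G.*2 ^ m * K.*2.+1) ^ n.+1)%N.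
  pose v (c : 'cV[R]_m.+1) j := c j 0 - x w j 0.
  (* The slab count divides by the largest entry of [v c], so [S c] is set to be empty when [v c]
     vanishes; the bound [1 <= L%:R * |v c j|] excludes this for the centres in use. *)
  pose j0 c := [arg max_(j > ord0) `|v c j| ]%O.
  pose S c : {set Z} := if v c (j0 c) == 0 then finset.set0 else
    [set z : Z | [forall i, (`|\sum_j ((z i j)%:R - G%:R) * v c j|
      <= K%:R * `|v c (j0 c)|)%R]]%SET.
  apply: (@card_covered _ _ _ S) => [z|c]; last first.
    by rewrite /S; case: eqP => [_|/eqP vc]; [rewrite cards0|exact: card_grid_slabs].
  rewrite inE => /andP[/repP[zcell _] /asboolP Bw].
  have [c cC [[j1 cj1] slab]] := Bslab _ _ k (leq_maxl _ _) Bw.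
  exists c => //.
  have vmax j : `|v c j| <= `|v c (j0 c)|.
    by rewrite /j0; case: arg_maxP => // i _ /(_ j isT).
  have vj0 : 1 <= L%:R * `|v c (j0 c)|.
    by apply: le_trans cj1 _; rewrite ler_wpM2l//; exact: vmax.
  rewrite /S ifF; last first.
    by apply/negP => /eqP v0; move: vj0; rewrite v0 normr0 mulr0 ler10.
  rewrite inE; apply/forallP => i.
  apply: (@grid_slab _ (rep z i) _ _ _ _ _ r0) => // j.
    by apply: ltW; exact: BL Bw _ _.
  by have /andP[] := zcell i j; rewrite mxE ler_norml; lra.
have sumP : #|ZB|%:R * eta <= (size (C k))%:R * ((G.*2)%:R ^+ m * K.*2.+1%:R) ^+ n.+1.
  have := @sum_probability_le R d T P Z ZB (fun z => B (rep z)) _ (fun z => mB _) count.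
  rewrite natrM natrX natrM natrX => /(le_trans _); rewrite -lee_fin; apply.
  have -> : (#|ZB|%:R * eta)%:E = (\sum_(z in ZB) eta%:E)%E.
    by rewrite sumEFin sumr_const mulr_natl.
  by apply: lee_sum => z /repP[_ /ltW].
(* Cells are half-open and covering boxes open, so each cell is enlarged to a box of side
   [2 * r]. *)
exists [seq (corner z - const_mx r, corner z + const_mx r) | z <- enum ZB]; split.
  move=> A badA; have [z zA] : exists z : Z, cell z A.
    (* An event of positive probability is nonempty, and any outcome in it gives the bound on the
       entries of [A] needed for rounding. *)
    have [w Bw] : exists w, B A w.
      apply/set0P/eqP => B0; move: badA; rewrite /= B0 measure0 lte_fin.
      by rewrite ltNge (ltW eta0).
    have zij i j := cid (@grid_round L r (A i j) r0 (BL _ _ Bw i j)).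
    exists [ffun i => [ffun j => sval (zij i j)]] => i j.
    by rewrite !mxE !ffunE; exact: (svalP (zij i j)).
  exists (corner z - const_mx r, corner z + const_mx r).
    by apply: map_f; rewrite mem_enum inE; apply/asboolP; exists A.
  by move=> i j; have := zA i j; rewrite !mxE; lra.
rewrite big_map/= [leLHS](_ : _ = #|ZB|%:R * (2 * r) ^+ (m.+1 * n.+1)); last first.
  rewrite big_enum/= mulr_natl -sumr_const; apply: eq_bigr => z _.
  rewrite exprM -[in RHS](card_ord n.+1) -[in RHS](card_ord m.+1).
  rewrite -!prodr_const; apply: eq_bigr => i _.
  apply: eq_bigr => j _; rewrite !mxE max_r; lra.
apply: le_trans Qk; rewrite -(ler_pM2r eta0) mulrAC.
apply: le_trans (ler_wpM2r _ sumP) _; first by rewrite exprn_ge0// mulr_ge0// ltW.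
rewrite /Q [leRHS]mulrAC divfK ?gt_eqF// [leRHS]mulrC.
(* Of the [m.+1 * n.+1] factors [r], [m * n.+1] compensate the grid size and the remaining [n.+1]
   meet the number of centres. *)
apply: le_trans (_ : ((size (C k))%:R * r ^+ n.+1) *
  (2 ^+ (m.+1 * n.+1) * ((r * (G.*2)%:R) ^+ m * K.*2.+1%:R) ^+ n.+1) <= _).
  rewrite le_eqVlt; apply/orP; left; apply/eqP.
  rewrite !exprMn exprM mulSn exprD !exprM; ring.
have rG : r * (G.*2)%:R <= 2 * (L%:R + 1).
  rewrite -mul2n natrM mulrCA ler_pM2l// /G -natr1 mulrDr mulr1 lerD//.
  rewrite mulrC -ler_pdivlMr// truncn_le divr_ge0// ltW//.
have rG0 : 0 <= r * (G.*2)%:R by rewrite mulr_ge0// ltW.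
apply: ler_pM => //.
- by rewrite mulr_ge0// exprn_ge0// ltW.
- by apply: mulr_ge0; apply: exprn_ge0 => //; apply: mulr_ge0 => //; exact: exprn_ge0.
- rewrite ler_pM2l ?exprn_gt0//; apply: lerXn2r; rewrite ?nnegrE//.
  + by apply: mulr_ge0 => //; exact: exprn_ge0.
  + by rewrite ler_wpM2r// lerXn2r ?nnegrE// mulr_ge0// addr_ge0.
Qed.

End SlabEvents.

(** * Economical covers from the lower Minkowski dimension *)

Section BoxDimension.
Context {R : realType}.

Lemma cov_num_ge0 (m : nat) (U : set 'cV[R]_m) (rho : R) : (0 <= cov_num U rho)%E.
Proof. by apply: le_ereal_inf_tmp => _ [k _ <-]; rewrite lee_fin. Qed.

Lemma mink_ratio_ge0 (m : nat) (U : set 'cV[R]_m) (rho : R) :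
  0 < rho < 1 -> (0 <= mink_ratio U rho)%E.
Proof.
move=> /andP[rho0 rho1]; have := cov_num_ge0 m U rho.
rewrite /mink_ratio; case E : (cov_num U rho) => [r| |]//= _.
rewrite lee_fin divr_ge0//; last by rewrite ln_ge0// invf_ge1// ltW.
(* A covering number below 1 comes from the empty cover; [ln] is 0 there by convention, so the ratio
   is 0. *)
have [r1|r1] := leP 1 r; first exact: ln_ge0.
have : (cov_num U rho < 1%:E)%E by rewrite E lte_fin.
move=> /ereal_inf_lt[_ [[|k] Uk <-]]; last by rewrite lte_fin ltrn1.
move=> _; rewrite ln0// -lee_fin -E; apply: ereal_inf_lbound.
by exists 0%N.
Qed.

Lemma lower_box_dim_ge0 (m : nat) (U : set 'cV[R]_m) : (0 <= lower_box_dim U)%E.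
Proof.
pose I (delta : R) := ereal_inf [set mink_ratio U rho | rho in [set rho : R | 0 < rho < delta]].
apply: (@le_trans _ _ (I 2^-1)); last first.
  by apply: ereal_sup_ubound; exists 2^-1 => //=; lra.
by apply: le_ereal_inf_tmp => _ [rho /= rho01 <-]; apply: mink_ratio_ge0; lra.
Qed.

Lemma le_eucl_norm (m : nat) (v : 'cV[R]_m) (j : 'I_m) : `|v j 0| <= eucl_norm v.
Proof.
rewrite -sqrtr_sqr; apply: ler_wsqrtr.
by rewrite (bigD1 j)//= lerDl; apply: sumr_ge0 => i _; exact: sqr_ge0.
Qed.

(** [expR (s * ln rho^-1)] is [rho] to the power [-s]. The additional 1 allows any cover with fewer
    than [r + 1] balls, so the infimum need not be shown to be attained. Only coordinatewise
    closeness to the centres is kept. *)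
Lemma mink_ratio_cover (m : nat) (U : set 'cV[R]_m) (rho s : R) :
  0 < rho < 1 -> (mink_ratio U rho < s%:E)%E ->
  exists2 C : seq 'cV[R]_m,
    forall v, U v -> exists2 c, c \in C & forall j, `|v j 0 - c j 0| <= rho &
    (size C)%:R <= 1 + expR (s * ln rho^-1).
Proof.
move=> /andP[rho0 rho1]; have := cov_num_ge0 m U rho.
rewrite /mink_ratio; case E : (cov_num U rho) => [r| |]//= _.
rewrite lte_fin ltr_pdivrMr; last by rewrite ln_gt0// invf_gt1.
move=> rs; have : (cov_num U rho < (r + 1)%:E)%E by rewrite E lte_fin ltrDl.
move=> /ereal_inf_lt[_ [k [c Uc] <-]]; rewrite lte_fin => kr.
exists (codom c) => [v /Uc[i vi]|].
  exists (c i); first exact: codom_f.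
  by move=> j; apply: le_trans (ltW vi); have := le_eucl_norm m (v - c i) j; rewrite !mxE.
rewrite size_codom card_ord; apply: (le_trans (ltW kr)).
rewrite addrC lerD2l; have [r0|r0] := leP r 0.
  by apply: le_trans r0 _; exact: expR_ge0.
by rewrite -[leLHS]lnK ?posrE// ler_expR ltW.
Qed.

(** For [s] strictly between the dimension and [n], arbitrarily small [rho] admit at most
    [1 + rho^(-s)] centres, and [rho^n + rho^(n-s)] tends to 0. *)
Lemma lower_box_dim_cover (m n : nat) (U : set 'cV[R]_m) (eps : R) :
  (lower_box_dim U < (n%:R)%:E)%E -> 0 < eps ->
  exists (C : seq 'cV[R]_m) (rho : R), [/\ 0 < rho <= eps,
    forall v, U v -> exists2 c, c \in C & forall j, `|v j 0 - c j 0| <= rho &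
    (size C)%:R * rho ^+ n <= eps].
Proof.
move=> dimU eps0.
have n0 : (0 < n)%N.
  by have := le_lt_trans (lower_box_dim_ge0 _ U) dimU; rewrite lte_fin ltr0n.
have [s dims sn] : exists2 s : R, (lower_box_dim U < s%:E)%E & s < n%:R.
  have := lower_box_dim_ge0 _ U; case: (lower_box_dim U) dimU => [r| |]//.
  rewrite lte_fin => rn _; exists ((r + n%:R) / 2); rewrite ?lte_fin; lra.
pose e := eps / 2; have e0 : 0 < e by rewrite divr_gt0.
(* The bound [e] controls [rho^n], [2^-1] keeps [rho] below 1, and the exponential makes [rho^(n-s)]
   at most [e]. *)
pose delta := Num.min (Num.min e 2^-1) (expR (ln e / (n%:R - s))).
have delta0 : 0 < delta by rewrite !lt_min e0 expR_gt0 invr_gt0 ltr0n.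
have delta1 : delta < 1 by rewrite !gt_min; apply/orP; left; apply/orP; right; lra.
have [rho rho0 rhos] : exists2 rho, 0 < rho < delta & (mink_ratio U rho < s%:E)%E.
  pose I := ereal_inf [set mink_ratio U rho | rho in [set rho : R | 0 < rho < delta]].
  have : (I < s%:E)%E.
    apply: le_lt_trans dims; apply: ereal_sup_ubound.
    by exists delta => //=; rewrite delta0.
  by move=> /ereal_inf_lt[_ [rho rho0 <-]]; exists rho.
have /andP[r0 rd] := rho0.
have [C UC sizeC] : exists2 C : seq 'cV[R]_m,
    forall v, U v -> exists2 c, c \in C & forall j, `|v j 0 - c j 0| <= rho &
    (size C)%:R <= 1 + expR (s * ln rho^-1).
  by apply: mink_ratio_cover => //; rewrite r0 (lt_trans rd).
move: rd; rewrite !lt_min => /andP[/andP[re r12] rexp].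
exists C, rho; split => //; first by rewrite r0/=; move: re; rewrite /e; lra.
apply: le_trans (ler_wpM2r _ sizeC) _; first by rewrite exprn_ge0// ltW.
rewrite mulrDl mul1r (_ : eps = e + e); last by rewrite /e; lra.
apply: lerD.
  apply: le_trans (ltW re); rewrite -(prednK n0) exprS ler_piMr// ?(ltW r0)//.
  by rewrite exprn_ile1// ?(ltW r0)//; lra.
rewrite -[X in X ^+ n]lnK ?posrE// -expRM_natl -expRD lnV ?posrE// -[leRHS]lnK ?posrE//.
rewrite ler_expR mulrN addrC -mulrBl mulrC.
move: rexp; rewrite -[X in X < _]lnK ?posrE// ltr_expR ltr_pdivlMr ?subr_gt0// => /ltW.
by [].
Qed.

End BoxDimension.

(** * The decoder and its Borel measurability *)

Lemma mx_continuous {R : realType} {X : topologicalType} (m n : nat)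
    (f : X -> 'M[R]_(m, n)) :
  (forall i j, continuous (fun x => f x i j)) -> continuous f.
Proof.
move=> cf x V [W nW WV].
apply: (@filterS _ (nbhs x) _ [set y | forall i j, W i j (f y i j)]) => [y Wy|].
  exact: WV.
apply: filter_forall => i; apply: filter_forall => j.
exact: cf (nW i j).
Qed.

Lemma continuous_sum {R : realType} {X : topologicalType} (I : Type) (s : seq I)
    (F : I -> X -> R) :
  (forall i, continuous (F i)) -> continuous (fun x => \sum_(i <- s) F i x).
Proof. by move=> cF; apply: continuous_big => //; exact: add_continuous. Qed.

Lemma borel_exists_seq {X : topologicalType} (I : eqType) (s : seq I)
    (F : I -> set X) :
  (forall i, borel_sets (F i)) -> borel_sets [set x | exists2 i, i \in s & F i x].
Proof.
move=> bF; rewrite (_ : [set x | _] =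
    [set x | exists k : 'I_(size s), F (tnth (in_tuple s) k) x]).
  exact: borel_exists.
apply/seteqP; split=> [x [i /(tnthP (in_tuple s))[k ->] Fix]|x [k Fkx]].
  by exists k.
by exists (tnth (in_tuple s) k) => //; exact: mem_tnth.
Qed.

(** If the set is nonempty and bounded below, its infimum is below [r] when some element is;
    otherwise [inf] is 0. Boundedness is tested with rational bounds to stay countable. *)
Lemma borel_inf_rat {R : realType} {X : topologicalType} (S : rat -> set X) (r : R) :
  (forall t, borel_sets (S t)) ->
  borel_sets [set z | inf [set ratr t | t in [set t | S t z]] < r].
Proof.
move=> bS; pose E z : set R := [set ratr t | t in [set t | S t z]].
rewrite (_ : [set z | _] = [set z |
  ((exists t, S t z) /\ (exists q : rat, forall t, ~ (S t z /\ t < q))) /\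
    (exists t, S t z /\ ratr t < r) \/
  ~ ((exists t, S t z) /\ (exists q : rat, forall t, ~ (S t z /\ t < q))) /\ 0 < r]).
  have blt (Q : rat -> Prop) t : borel_sets [set z | S t z /\ Q t].
    by apply: borel_and; [exact: bS|exact: (@borel_cst X (Q t))].
  have binf : borel_sets [set z : X |
      (exists t, S t z) /\ (exists q : rat, forall t, ~ (S t z /\ t < q))].
    apply: borel_and; first exact: borel_exists.
    apply: borel_exists => q; apply: borel_forall => t; apply: borel_not.
    exact: (blt (fun t => t < q)).
  apply: borel_or; apply: borel_and => //; last exact: (@borel_cst X (0 < r)).
    by apply: borel_exists => t; exact: (blt (fun t => ratr t < r)).
  exact: borel_not.
have infP z : has_inf (E z) <->
    (exists t, S t z) /\ (exists q : rat, forall t, ~ (S t z /\ t < q)).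
  split=> [[[_ [t Stz _]] [b Eb]]|[[t Stz] [q Sq]]].
    split; first by exists t.
    have /rat_in_itvoo[q] : b - 1 < b by rewrite gtrBl.
    rewrite in_itv/= => /andP[_ qb]; exists q => t' [St'z]; apply/negP.
    rewrite -leNgt -(ler_rat R); apply: le_trans (ltW qb) _.
    by apply: Eb; exists t'.
  split; first by exists (ratr t), t.
  exists (ratr q) => _ [t' St'z <-]; rewrite ler_rat leNgt; apply/negP => t'q.
  exact: (Sq t').
apply/seteqP; split=> z /=; rewrite -infP -/(E z).
  have [hinf|ninf] := pselect (has_inf (E z)); last by rewrite inf_out//; right.
  move=> /inf_lt[|_ [t Stz <-] tr]; first exact: hinf.1.
  by left; split => //; exists t.
move=> [[hinf [t [Stz tr]]]|[ninf r0]]; last by rewrite inf_out.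
by apply: le_lt_trans tr; apply: ge_inf; [exact: hinf.2|exists t].
Qed.

Section Decoder.
Context {R : realType} {n m : nat}.

(* (A, y) passes this test when, at every scale k, some centre c satisfies
   A c = y up to the error caused by moving c by rho k, and c l <= t + rho k. *)
Definition consistent (C : nat -> seq 'cV[R]_m) (rho : nat -> R) (l : 'I_m)
    (t : rat) : set ('M[R]_(n, m) * 'cV[R]_n) :=
  [set Ay : 'M[R]_(n, m) * 'cV[R]_n | forall k, exists2 c, c \in C k &
    c l 0 <= ratr t + rho k /\
    forall i, `|\sum_j Ay.1 i j * c j 0 - Ay.2 i 0| <= rho k * \sum_j `|Ay.1 i j| ].

Lemma borel_consistent C rho l t : borel_sets (consistent C rho l t).
Proof.
pose X : topologicalType := ('M[R]_(n, m) * 'cV[R]_n)%type.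
have c1 i j : continuous (fun Ay : X => Ay.1 i j).
  move=> Ay; apply: (@continuous_comp X _ _ fst (fun M : 'M[R]_(n, m) => M i j)).
    exact: cvg_fst.
  exact: coord_continuous.
have c2 i : continuous (fun Ay : X => Ay.2 i 0).
  move=> Ay; apply: (@continuous_comp X _ _ snd (fun M : 'cV[R]_n => M i 0)).
    exact: cvg_snd.
  exact: coord_continuous.
apply: borel_forall => k; apply: borel_exists_seq => c; apply: borel_and.
  exact: borel_cst.
apply: borel_forall => i; apply: borel_continuous_le => Ay.
  apply: cvg_norm; apply: cvgB; last exact: c2.
  by apply: continuous_sum => j {}Ay; apply: cvgMl; exact: c1.
apply: cvgMr; apply: continuous_sum => j {}Ay; apply: cvg_norm; exact: c1.
Qed.

(* inf is 0 on empty sets and on sets unbounded below. *)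
Definition decoder (C : nat -> nat -> seq 'cV[R]_m) (rho : nat -> nat -> R)
    (Ay : 'M[R]_(n, m) * 'cV[R]_n) : 'cV[R]_m :=
  \col_l inf [set ratr t | t in
    [set t : rat | exists i, consistent (C i) (rho i) l t Ay]].

Lemma borel_decoder C rho : borel_measurable (decoder C rho).
Proof.
apply: borel_measurable_mx => l j r.
rewrite (_ : [set z | _] = [set z | inf [set ratr t | t in
    [set t : rat | exists i, consistent (C i) (rho i) l t z]] < r]).
  apply: borel_inf_rat => t; apply: borel_exists => i; exact: borel_consistent.
by apply/seteqP; split=> z /=; rewrite mxE.
Qed.

Lemma continuous_pair_mulmx (A : 'M[R]_(n, m)) :
  continuous (fun u : 'cV[R]_m => (A, A *m u)).
Proof.
move=> u.
apply: (@cvg_pair _ _ _ (nbhs u) (nbhs A) (nbhs (A *m u)) _ _ _ (fun=> A) (mulmx A)).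
  exact: cvg_cst.
apply: mx_continuous => i j {}u.
rewrite (_ : (fun x => _) = fun x : 'cV[R]_m => \sum_k A i k * x k j).
  apply: continuous_sum => k {}u; apply: cvgMr; first exact: (nbhs_filter u).
  exact: (@coord_continuous R m 1 k j).
by apply/funext => v; rewrite mxE.
Qed.

(** Two distinct reals are separated by a rational, so the set is a countable union over coordinates
    and rationals. This makes the failure event measurable for fixed [A]. *)
Lemma borel_decoder_error C rho (A : 'M[R]_(n, m)) :
  borel_sets [set u | decoder C rho (A, A *m u) != u].
Proof.
pose h u := decoder C rho (A, A *m u).
have bh l (r : R) : borel_sets [set u | h u l 0 < r].
  apply: (continuous_borel _ _ (continuous_pair_mulmx A)
    [set z | decoder C rho z l 0 < r]).
  have := borel_decoder C rho [set v | v l 0 < r]; apply.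
  by apply: borel_continuous_lt; exact: coord_continuous.
have bu l (r : R) : borel_sets [set u : 'cV[R]_m | u l 0 < r].
  by apply: borel_continuous_lt; exact: coord_continuous.
rewrite (_ : [set u | _] = [set u | exists l, exists q : rat,
   h u l 0 < ratr q /\ ~ u l 0 < ratr q \/ u l 0 < ratr q /\ ~ h u l 0 < ratr q]).
  apply: borel_exists => l; apply: borel_exists => q.
  by apply: borel_or; apply: borel_and => //; exact: borel_not.
apply/seteqP; split=> u /=; last first.
  by move=> [l [q [[h1 h2]|[h1 h2]]]]; apply/eqP => hu; apply: h2; move: h1; rewrite /h hu.
move=> hu; apply: contrapT => nlq; move/eqP : hu; apply.
apply/colP => l; apply/eqP; rewrite eq_le; apply/andP; split; rewrite leNgt; apply/negP.
  move=> /rat_in_itvoo[q]; rewrite in_itv/= => /andP[uq qh]; apply: nlq.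
  by exists l, q; right; split => //; apply/negP; rewrite -leNgt ltW.
move=> /rat_in_itvoo[q]; rewrite in_itv/= => /andP[hq qu]; apply: nlq.
by exists l, q; left; split => //; apply/negP; rewrite -leNgt ltW.
Qed.

End Decoder.

(** * Recovery for almost every matrix *)

Section Recovery.
Context {R : realType} {d : measure_display} {T : measurableType d}.
Context (P : probability T R) {n m : nat} (x : T -> 'cV[R]_m.+1).
Context (C : nat -> nat -> seq 'cV[R]_m.+1) (rho : nat -> nat -> R).
Context (x_rv : random_vector x).
Context (rho_bound : forall i k, 0 < rho i k <= k.+1%:R^-1).

(* The test (i, t) makes the decoder underestimate x l by at least 2 / (p + 1). *)
Definition bad_event (i : nat) (l : 'I_m.+1) (t : rat) (p : nat)
    (A : 'M[R]_(n.+1, m.+1)) : set T :=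
  [set w | (forall i' j, `|A i' j| < p.+1%:R) /\
    (ratr t + 2 / p.+1%:R <= x w l 0 /\
     consistent (C i) (rho i) l t (A, A *m x w))].

Lemma measurable_bad_event i l t p A : measurable (bad_event i l t p A).
Proof.
pose S := [set u : 'cV[R]_m.+1 | (forall i' j, `|A i' j| < p.+1%:R) /\
    (ratr t + 2 / p.+1%:R <= u l 0 /\ consistent (C i) (rho i) l t (A, A *m u))].
suff bS : borel_sets S by exact: (x_rv S bS).
apply: borel_and; first exact: borel_cst.
apply: borel_and.
  by apply: (borel_continuous_le (cst _)); [exact: cst_continuous|exact: coord_continuous].
exact: (continuous_borel _ _ (continuous_pair_mulmx A) _ (borel_consistent (C i) (rho i) l t)).
Qed.

Lemma leb_null_bad_event i l t p (eta : R) :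
  (forall k, (size (C i k))%:R * rho i k ^+ n.+1 <= k.+1%:R^-1) ->
  0 < eta -> leb_null [set A | (eta%:E < P (bad_event i l t p A))%E].
Proof.
move=> sizeC; apply: (@leb_null_slab_event _ _ _ _ _ _ p.+1 x _ (C i) (rho i)) => //.
- move=> k; have /andP[-> /=] := rho_bound i k => /le_trans; apply.
  by rewrite invf_le1 ?ler1n.
- exact: measurable_bad_event.
- by move=> A w [].
move=> A w k pk [_ [tx /(_ k)[c cC [ct slab]]]]; exists c => //; split.
  (* From [p.+1 <= k] the radius is at most [1 / p.+1]; it uses up half of the gap [2 / p.+1] and
     leaves [c l] at distance at least [1 / p.+1] from [x l]. *)
  exists l; have /andP[_ rk] := rho_bound i k.
  have kp : k.+1%:R^-1 <= p.+1%:R^-1 :> R.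
    by rewrite lef_pV2 ?posrE// ler_nat ltnS ltnW.
  rewrite -ler_pdivrMl// mulr1 distrC ler_normr; apply/orP; left.
  by move: (k.+1%:R^-1) (p.+1%:R^-1) rk kp tx => kV pV *; lra.
move=> i'; rewrite (_ : \sum_j _ = \sum_j A i' j * c j 0 - (A *m x w) i' 0) //.
by rewrite mxE -sumrB; apply: eq_bigr => j _; rewrite mulrBr.
Qed.

(** Every rational [t >= x l] passes the test of the set [F i] containing [x w], through centres
    close to [x w]. A smaller [t] that passes would put [w] in a bad event. Hence the infimum is
    [x l]. *)
Lemma decoder_correct (F : nat -> set 'cV[R]_m.+1) (A : 'M[R]_(n.+1, m.+1)) (w : T) :
  (forall i k v, F i v ->
    exists2 c, c \in C i k & forall j, `|v j 0 - c j 0| <= rho i k) ->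
  (exists i, F i (x w)) -> (forall i l t p, ~ bad_event i l t p A w) ->
  decoder C rho (A, A *m x w) = x w.
Proof.
move=> FC [i Fi] good; apply/colP => l; rewrite mxE.
set S := [set ratr t | t in _].
have Sge t : x w l 0 <= ratr t -> S (ratr t).
  move=> xt; exists t => //; exists i => k; have [c cC cx] := FC i k _ Fi.
  exists c => //; split; first by have := cx l; rewrite ler_norml; lra.
  move=> i'; rewrite /= mxE -sumrB mulr_sumr; apply: le_trans (ler_norm_sum _ _ _) _.
  by apply: ler_sum => j _; rewrite -mulrBr normrM mulrC ler_wpM2r// distrC.
have Slb : lbound S (x w l 0).
  move=> _ [t [i' ct] <-]; rewrite leNgt; apply/negP => tx.
  pose M := \sum_i1 \sum_j `|A i1 j|.
  (* [p.+1] exceeds every entry of [A] in absolute value and makes [2 / p.+1] smaller than the gap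
     between [t] and [x l]. *)
  pose p := Num.trunc (Num.max M (2 / (x w l 0 - ratr t))).
  have : Num.max M (2 / (x w l 0 - ratr t)) < p.+1%:R by exact: truncnS_gt.
  rewrite gt_max => /andP[Mp tp]; apply: (good i' l t p); split.
    move=> i1 j; apply: le_lt_trans Mp.
    rewrite /M (bigD1 i1)//= (bigD1 j)//= -addrA lerDl addr_ge0 ?sumr_ge0// => ? _.
    exact: sumr_ge0.
  split=> //; rewrite -lerBrDl ler_pdivrMr// mulrC -ler_pdivrMr ?subr_gt0//.
  exact: ltW.
have S0 : S !=set0.
  have /rat_in_itvoo[q] : x w l 0 < x w l 0 + 1 by rewrite ltrDl.
  by rewrite in_itv/= => /andP[/ltW/Sge Sq _]; exists (ratr q).
apply/eqP; rewrite eq_le (lb_le_inf S0 Slb) andbT leNgt; apply/negP.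
move=> /rat_in_itvoo[q]; rewrite in_itv/= => /andP[/ltW/Sge Sq].
by rewrite ltNge ge_inf//; exists (x w l 0).
Qed.

(** Outside a countable union of null sets, indexed by the bad events and thresholds [1 / q.+1], all
    bad events of [A] have probability 0. Failure then lies in their union with the complement of
    [E]. *)
Lemma decoder_ae (F : nat -> set 'cV[R]_m.+1) (U : set 'cV[R]_m.+1) :
  (forall i k, (size (C i k))%:R * rho i k ^+ n.+1 <= k.+1%:R^-1) ->
  (forall i k v, F i v ->
    exists2 c, c \in C i k & forall j, `|v j 0 - c j 0| <= rho i k) ->
  support_set P x U -> U `<=` \bigcup_i F i ->
  leb_ae (fun A : 'M[R]_(n.+1, m.+1) =>
    P [set w | decoder C rho (A, A *m x w) != x w] = 0%E).
Proof.
move=> sizeC FC [E [mE [PE EU]]] UF.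
pose I : countType := (nat * 'I_m.+1 * rat * nat)%type.
pose B (a : I) A := bad_event a.1.1.1 a.1.1.2 a.1.2 a.2 A.
pose N (aq : I * nat) : set 'M[R]_(n.+1, m.+1) :=
  [set A | ((aq.2.+1%:R^-1)%:E < P (B aq.1 A))%E].
apply: (@leb_null_sub _ _ _ _ [set A | exists aq, N aq A]); last first.
  by apply: leb_null_exists => aq; exact: leb_null_bad_event.
move=> A /= PA; apply: contrapT => nN; apply: PA.
have B0 a : P.-negligible (B a A).
  exists (B a A); split => //; first exact: measurable_bad_event.
  apply: contrapT => /eqP PB; apply: nN.
  have := fin_num_measure P _ (measurable_bad_event a.1.1.1 a.1.1.2 a.1.2 a.2 A).
  move=> /fineK PBfin; have : 0 < fine (P (B a A)).
    by rewrite -lte_fin PBfin lt_neqAle eq_sym PB measure_ge0.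
  move=> /ltr_add_invr[q]; rewrite add0r => qP.
  by exists (a, q); rewrite /N/= -PBfin lte_fin.
apply: measure_negligible.
  exact: (x_rv [set u | decoder C rho (A, A *m u) != u] (borel_decoder_error C rho A)).
(* Numbers that code no index are sent to the complement of [E], which is negligible too. *)
pose G k := if @unpickle I k is Some a then B a A else ~` E.
apply: (@negligibleS _ _ _ _ (~` E `|` \bigcup_k G k)) => [w /= wx|].
  apply: contrapT => /not_orP[/contrapT Ew nG]; move/eqP : wx; apply.
  apply: (decoder_correct F) => //; first by have [i _ Fi] := UF _ (EU _ Ew); exists i.
  move=> i l t p Bw; apply: nG; exists (pickle ((i, l, t, p) : I)) => //.
  by rewrite /G pickleK.
have nE : P.-negligible (~` E).
  exists (~` E); split => //; first exact: measurableC.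
  by rewrite probability_setC// PE subee.
apply: negligibleU => //; apply: negligible_bigcup => k; rewrite /G.
by case: unpickle.
Qed.

End Recovery.

Theorem theorem1 (R : realType) (d : measure_display) (T : measurableType d)
  (P : probability T R) (m n : nat) (x : T -> 'cV[R]_m) :
  random_vector x ->
  (n <= m)%N ->
  (descr_complexity P x < (n%:R)%:E)%E ->
  exists g : 'M[R]_(n, m) * 'cV[R]_n -> 'cV[R]_m,
    borel_measurable g /\
    leb_ae (fun A : 'M[R]_(n, m) =>
      P [set w | g (A, A *m x w) != x w] = 0%E).
Proof.
move=> x_rv nm /ereal_inf_lt[_ [U suppU <-]] /ereal_inf_lt[_ [F [UF _] <-]] dimF.
have dim i : (lower_box_dim (F i) < (n%:R)%:E)%E.
  by apply: le_lt_trans dimF; apply: ereal_sup_ubound; exists i.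
(* Dimensions are nonnegative, so [n] is positive, and so is [m] by [n <= m]; both can be written as
   successors. *)
have n0 : (0 < n)%N.
  by have := le_lt_trans (lower_box_dim_ge0 _ (F 0%N)) (dim 0%N); rewrite lte_fin ltr0n.
case: n m n0 nm x x_rv U suppU F UF dimF dim => [//|n] [//|m] _ _ x x_rv U suppU F UF _ dim.
have cover i k : {Crho : seq 'cV[R]_m.+1 * R | [/\ 0 < Crho.2 <= k.+1%:R^-1,
    forall v, F i v -> exists2 c, c \in Crho.1 & forall j, `|v j 0 - c j 0| <= Crho.2 &
    (size Crho.1)%:R * Crho.2 ^+ n.+1 <= k.+1%:R^-1]}.
  apply: cid; have [|C [rho CrhoP]] := @lower_box_dim_cover R _ n.+1 (F i) k.+1%:R^-1 (dim i).
    by rewrite invr_gt0.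
  by exists (C, rho).
pose C i k := (sval (cover i k)).1; pose rho i k := (sval (cover i k)).2.
exists (decoder C rho); split; first exact: borel_decoder.
apply: (decoder_ae P x C rho x_rv _ F U) => // i k; by case: (svalP (cover i k)).
Qed.
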